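(* Let $G$ be a tree, and for each $k\ge1$ let $n_k$ denote the number of vertices of $G$ of degree $k$. If \[ \left\lceil 2\sqrt{\frac{n_2+n_3+n_4+\cdots}{3}}\ \right\rceil+2\ \le\ \left\lceil\sqrt{2+n_2+2n_3+3n_4+\cdots}\ \right\rceil, \] then $G$ is well-burnable.
   Context: Burning process on a graph $G$: in round 1 one vertex is chosen and set on fire; in each subsequent round, first every burning vertex sets all its neighbours on fire, then one new vertex is chosen and set on fire; the process ends when all vertices are on fire. The burning number $b(G)$ is the minimum number of rounds needed. A graph on $n$ vertices is well-burnable if $b(G)\le\lceil\sqrt n\,\rceil$. *)

(* Defs.v *)
From HB Require Import structures.
From mathcomp Require Import all_boot all_order all_algebra.
From mathcomp Require Import reals.

Set Implicit Arguments.
Unset Strict Implicit.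
Unset Printing Implicit Defensive.

Import Order.TTheory GRing.Theory Num.Theory.

(* A graph on the vertex set T is an adjacency relation e : rel T. *)

Definition simple_graph (T : finType) (e : rel T) : Prop :=
  symmetric e /\ irreflexive e.

Definition graph_connected (T : finType) (e : rel T) : Prop :=
  (0 < #|T|)%N /\ forall x y : T, connect e x y.

Definition graph_acyclic (T : finType) (e : rel T) : Prop :=
  forall c : seq T, (2 < size c)%N -> ~ ucycle e c.

Definition tree (T : finType) (e : rel T) : Prop :=
  [/\ simple_graph e, graph_connected e & graph_acyclic e].

Definition degree (T : finType) (e : rel T) (x : T) : nat :=
  #|[set y | e x y]|.

Definition num_deg (T : finType) (e : rel T) (k : nat) : nat :=
  #|[set x | degree e x == k]|.

Definition spread (T : finType) (e : rel T) (B : {set T}) : {set T} :=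
  B :|: [set y | [exists x in B, e x y]].

(* burn_round e B B': one round can lead from the set B of burning vertices to
   B'. No round starts once every vertex burns. The vertex chosen after the
   spreading is one that is not yet on fire; there is none to choose exactly
   when the spreading has already reached every vertex. From B = set0 the
   spreading does nothing, so the first round sets a single vertex on fire. *)
Definition burn_round (T : finType) (e : rel T) : rel {set T} :=
  fun B B' =>
    (B != [set: T]) &&
    (if spread e B == [set: T] then B' == [set: T]
     else [exists x, (x \notin spread e B) && (B' == x |: spread e B)]).

(* Entry i of the tuple is the set of vertices on fire after round i + 1. *)
Definition burns_in (T : finType) (e : rel T) (m : nat) : bool :=
  [exists p : m.-tuple {set T},
     path (burn_round e) set0 p && (last set0 p == [set: T])].

Lemma burns_in_ex (T : finType) (e : rel T) : exists m, burns_in e m.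
Proof.
suff [p pP] : exists p : seq {set T},
    path (burn_round e) set0 p && (last set0 p == [set: T]).
  by exists (size p); apply/existsP; exists (in_tuple p).
move: (set0 : {set T}) => B.
have [n] := ubnP #|~: B|; elim: n B => // n IHn B /ltnSE leBn.
have [BT|BnT] := eqVneq B [set: T]; first by exists [::]; rewrite /= BT eqxx.
have [ST|SnT] := eqVneq (spread e B) [set: T].
  by exists [:: [set: T]]; rewrite /= /burn_round BnT ST !eqxx.
have [x xS] : exists x, x \notin spread e B.
  have: ~~ ([set: T] \subset spread e B) by rewrite subTset.
  by case/subsetPn=> x _ xS; exists x.
have ltB : (#|~: (x |: spread e B)| < #|~: B|)%N.
  apply: proper_card; apply/properP; split.
    by rewrite setCS; apply: subset_trans (subsetUl B _) (subsetUr _ _).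
  exists x; last by rewrite !inE eqxx.
  by move: xS; rewrite !inE negb_or => /andP[].
have [p /andP[pP pT]] := IHn _ (leq_trans ltB leBn).
exists ((x |: spread e B) :: p); rewrite /= pP pT !andbT.
rewrite /burn_round BnT (negPf SnT) /=.
by apply/existsP; exists x; rewrite xS eqxx.
Qed.

Definition burning_number (T : finType) (e : rel T) : nat :=
  ex_minn (burns_in_ex e).

Definition well_burnable (R : realType) (T : finType) (e : rel T) : Prop :=
  ((burning_number e)%:Z <= Num.ceil (Num.sqrt (#|T|%:R : R)))%R.

(* Main.v *)
Require Import Defs.
From HB Require Import structures.
From mathcomp Require Import all_boot all_order all_algebra.
From mathcomp Require Import reals.
From mathcomp Require Import zify lra.

(** Let [M] be the number of vertices of degree at least 2 and
    [k = ceil (2 sqrt (M / 3))].  These vertices span a subtree [X]; if balls of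
    radii [0, ..., k] cover it, then [k + 2] rounds burn the whole tree, since
    one more step reaches the leaves.  In a tree, [2 + n_2 + 2 n_3 + ...] is the
    number of vertices, so the hypothesis says exactly that [k + 2] rounds are
    good enough.

    To cover [X] by balls of radii [0, ..., K - 1], root it and remove, one ball
    after the other, a set that is covered by a ball of an unused radius and
    whose complement still contains the parents of its members.  When [m] radii
    are unused, some unused radius [r] removes at least [2 r - max (0, K - 2 m)]
    vertices.  The losses add up to at most [(K - 1)^2 / 4], so that
    [K (K - 1) - (K - 1)^2 / 4 >= 3 (K - 1)^2 / 4] vertices can be covered. *)

Set Implicit Arguments.
Unset Strict Implicit.
Unset Printing Implicit Defensive.

(** * Balls as iterated spreading *)

Definition reach (T : finType) (e : rel T) (r : nat) (x y : T) : bool :=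
  y \in iter r (spread e) [set x].

Lemma subset_spread (T : finType) (e : rel T) (B : {set T}) : B \subset spread e B.
Proof. exact: subsetUl. Qed.

Lemma spreadS (T : finType) (e : rel T) (B C : {set T}) :
  B \subset C -> spread e B \subset spread e C.
Proof.
move=> sBC; apply: setUSS => //; apply/subsetP => y; rewrite !inE.
by case/existsP=> x /andP[xB exy]; apply/existsP; exists x; rewrite exy (subsetP sBC).
Qed.

Lemma iter_spreadS (T : finType) (e : rel T) n (B C : {set T}) :
  B \subset C -> iter n (spread e) B \subset iter n (spread e) C.
Proof. by move=> sBC; elim: n => //= n; apply: spreadS. Qed.

Lemma reachxx (T : finType) (e : rel T) x : reach e 0 x x.
Proof. by rewrite /reach inE. Qed.

Lemma reach_edge (T : finType) (e : rel T) x y : e x y -> reach e 1 x y.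
Proof.
move=> exy; rewrite /reach /= !inE; apply/orP; right.
by apply/existsP; exists x; rewrite inE eqxx.
Qed.

Lemma reach_trans (T : finType) (e : rel T) a b x y z :
  reach e a x y -> reach e b y z -> reach e (a + b) x z.
Proof.
rewrite /reach addnC iterD => xy; apply: subsetP z; apply: iter_spreadS.
by rewrite sub1set.
Qed.

Lemma reach_leq (T : finType) (e : rel T) a b x y :
  a <= b -> reach e a x y -> reach e b x y.
Proof.
move=> /subnK <- xy; rewrite addnC; apply: reach_trans xy _.
elim: (b - a) => [|n IHn]; first exact: reachxx.
by rewrite /reach iterS; apply: (subsetP (subset_spread _ _)).
Qed.

(** * Burning and covering by balls *)

(** Entry [i] of [cs] is to be lit in round [i + 1], which leaves [size cs - i.+1] rounds of
    spreading. An entry that is already on fire is replaced by any unburnt vertex, which only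
    helps. *)
Lemma burns_from_cover (T : finType) (e : rel T) (cs : seq T) (B : {set T}) :
    (forall x, x \in iter (size cs) (spread e) B \/
       exists2 i, i < size cs & reach e (size cs - i.+1) (nth x cs i) x) ->
  exists2 p, size p <= size cs &
    path (burn_round e) B p && (last B p == [set: T]).
Proof.
elim: cs B => [|c cs IHcs] B /= cov.
  exists [::] => //=; apply/eqP/setP => x; rewrite inE.
  by case: (cov x) => // -[].
have [BT|BnT] := eqVneq B [set: T]; first by exists [::]; rewrite //= BT.
have [ST|SnT] := eqVneq (spread e B) [set: T].
  by exists [:: [set: T]] => //; rewrite /= /burn_round BnT ST !eqxx.
have [z [zS cz]] : exists z, z \notin spread e B /\ c \in z |: spread e B.
  have [cS|cS] := boolP (c \in spread e B); last first.
    by exists c; split=> //; rewrite setU11.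
  have: ~~ ([set: T] \subset spread e B) by rewrite subTset.
  by case/subsetPn=> z _ zS; exists z; split=> //; rewrite inE cS orbT.
have [|p sp /andP[pP pT]] := IHcs (z |: spread e B).
  move=> x; case: (cov x) => [xB|[[|i] ilt xi]]; last by right; exists i.
    left; move: xB; rewrite -iterS iterSr.
    by apply: subsetP x; apply: iter_spreadS; apply: subsetUr.
  left; move: xi; rewrite /= subn1 /=.
  by apply: subsetP x; apply: iter_spreadS; rewrite sub1set.
exists ((z |: spread e B) :: p) => //=; rewrite pP pT /burn_round BnT (negPf SnT) /=.
by rewrite !andbT; apply/existsP; exists z; rewrite zS eqxx.
Qed.

Lemma burning_number_cover (T : finType) (e : rel T) k (c : nat -> T) :
    (forall x, exists2 r, r < k & reach e r (c r) x) ->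
  burning_number e <= k.
Proof.
move=> cov.
(* The largest radius needs the most rounds, so the centres are lit in reverse order. *)
have sz : size (rev (mkseq c k)) = k by rewrite size_rev size_mkseq.
have [|p] := @burns_from_cover T e (rev (mkseq c k)) set0.
  move=> x; right; rewrite sz; have [r ltrk xr] := cov x.
  exists (k - r.+1); first by lia.
  rewrite nth_rev size_mkseq; last by lia.
  rewrite nth_mkseq; last by lia.
  by rewrite (_ : k - (k - r.+1).+1 = r); last by lia.
rewrite sz => sp pP; apply: leq_trans sp; rewrite /burning_number.
case: ex_minnP => m _; apply; apply/existsP.
by exists (in_tuple p).
Qed.

(** * Rooted spanning trees *)

(** The truncated predecessor makes the root its own parent, so iterating [par] beyond the root is
    harmless. *)
Record rooting (T : finType) (e : rel T) (par : T -> T) (d : T -> nat) (r : T)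
    : Prop := Rooting {
  depth_par : forall x, d (par x) = (d x).-1;
  depth_eq0 : forall x, d x = 0 -> x = r;
  edge_par : forall x, 0 < d x -> e x (par x)
}.

Lemma rooting_exists (T : finType) (e : rel T) (r : T) :
    symmetric e -> (forall x, connect e r x) ->
  exists par d, rooting e par d r.
Proof.
move=> esym conn.
have rch x : exists n, reach e n r x.
  have /connectP[p pP ->] := conn x; exists (size p).
  elim: p {conn} r pP => [|y p IHp] z /=; first by rewrite reachxx.
  by case/andP=> ezy /IHp; apply: (@reach_trans _ _ 1); apply: reach_edge.
(* Depth is the graph distance from [r]; a parent is a neighbour one step closer. *)
pose d x := ex_minn (rch x).
have dP x : reach e (d x) r x by rewrite /d; case: ex_minnP.
have dmin x n : reach e n r x -> d x <= n.
  by rewrite /d; case: ex_minnP => m _ mmin; apply: mmin.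
have nb x : 0 < d x -> [exists y, e x y && (d y == (d x).-1)].
  case E: (d x) => [//|n] _ /=; have := dP x; rewrite E /reach iterS inE.
  case/orP=> [/dmin|]; first by rewrite E ltnn.
  rewrite inE => /existsP[y /andP[yB eyx]].
  apply/existsP; exists y; rewrite esym eyx eqn_leq dmin //= -ltnS -E.
  by apply: dmin; rewrite -addn1; apply: reach_trans (dP y) (reach_edge eyx).
have d0 x : d x = 0 -> x = r.
  by move=> dx; have := dP x; rewrite dx /reach inE => /eqP.
pose par x := odflt x [pick y | e x y && (d y == (d x).-1)].
have parP x : 0 < d x -> e x (par x) /\ d (par x) = (d x).-1.
  move=> /nb/existsP[y yP]; rewrite /par.
  by case: pickP => [z /andP[? /eqP]//|/(_ y)]; rewrite yP.
exists par, d; split=> // [x|x /parP[]//].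
have [dx|/parP[]//] := posnP (d x).
rewrite dx /par; case: pickP => [z /andP[_ /eqP]|_] /=; by rewrite dx.
Qed.

Lemma depth_iter (T : finType) (e : rel T) par d r (rt : rooting e par d r) i x :
  d (iter i par x) = d x - i.
Proof. by elim: i => [|i IHi] /=; rewrite ?subn0 // (depth_par rt) IHi subnS. Qed.

Lemma iter_depth (T : finType) (e : rel T) par d r (rt : rooting e par d r) x :
  iter (d x) par x = r.
Proof. by apply: (depth_eq0 rt); rewrite (depth_iter rt) subnn. Qed.

Lemma par_root (T : finType) (e : rel T) par d r (rt : rooting e par d r) :
  par r = r.
Proof.
apply: (depth_eq0 rt); rewrite (depth_par rt) -(iter_depth rt r) (depth_iter rt).
by rewrite subnn.
Qed.

Lemma reach_up (T : finType) (e : rel T) par d r (rt : rooting e par d r) i x :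
  reach e i x (iter i par x).
Proof.
elim: i => [|i IHi]; first exact: reachxx.
have [d0|dp] := posnP (d (iter i par x)).
  apply: reach_leq (leqnSn i) _; rewrite /= (depth_eq0 rt d0) (par_root rt).
  by rewrite -(depth_eq0 rt d0).
rewrite -addn1; apply: reach_trans IHi _; apply: reach_edge.
by rewrite addn1; apply: (edge_par rt).
Qed.

Lemma reach_down (T : finType) (e : rel T) par d r (rt : rooting e par d r) i x :
  symmetric e -> reach e i (iter i par x) x.
Proof.
move=> esym; elim: i => [|i IHi]; first exact: reachxx.
have [d0|dp] := posnP (d (iter i par x)).
  apply: reach_leq (leqnSn i) _; rewrite /= (depth_eq0 rt d0) (par_root rt).
  by rewrite -(depth_eq0 rt d0).
rewrite -addn1 addnC; apply: reach_trans IHi.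
by apply: reach_edge; rewrite esym add1n; apply: (edge_par rt).
Qed.

(** * Position of a vertex relative to the path from [u] to the root *)

Definition spine (T : finType) (par : T -> T) (d : T -> nat) (u : T) : seq T :=
  traject par u (d u).+1.

(* The path from [x] to the root meets the path from [u] to the root for the
   first time at [iter (idx x) par u = iter (off x) par x], so [idx x + off x]
   is the distance from [u] to [x] in the tree. *)
Definition off (T : finType) (par : T -> T) (d : T -> nat) (u x : T) : nat :=
  find (mem (spine par d u)) (traject par x (d x).+1).

Definition idx (T : finType) (par : T -> T) (d : T -> nat) (u x : T) : nat :=
  index (iter (off par d u x) par x) (spine par d u).

Lemma has_spine (T : finType) (e : rel T) par d r (rt : rooting e par d r) u x :
  has (mem (spine par d u)) (traject par x (d x).+1).
Proof.
apply/hasP; exists r; first by apply/trajectP; exists (d x); rewrite ?(iter_depth rt).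
by apply/trajectP; exists (d u); rewrite ?(iter_depth rt).
Qed.

Lemma off_le (T : finType) (e : rel T) par d r (rt : rooting e par d r) u x :
  off par d u x <= d x.
Proof. by have := has_spine rt u x; rewrite has_find size_traject. Qed.

Lemma off_in (T : finType) (e : rel T) par d r (rt : rooting e par d r) u x :
  iter (off par d u x) par x \in spine par d u.
Proof.
have := nth_find x (has_spine rt u x); rewrite -/(off par d u x) nth_traject //.
by rewrite ltnS (off_le rt).
Qed.

Lemma idx_le (T : finType) (e : rel T) par d r (rt : rooting e par d r) u x :
  idx par d u x <= d u.
Proof. by have := off_in rt u x; rewrite -index_mem size_traject. Qed.

Lemma iter_off (T : finType) (e : rel T) par d r (rt : rooting e par d r) u x :
  iter (off par d u x) par x = iter (idx par d u x) par u.
Proof.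
by have := nth_index u (off_in rt u x); rewrite nth_traject // ltnS (idx_le rt).
Qed.

Lemma depth_off (T : finType) (e : rel T) par d r (rt : rooting e par d r) u x :
  d x + idx par d u x = d u + off par d u x.
Proof.
have := congr1 d (iter_off rt u x); rewrite !(depth_iter rt).
by have := off_le rt u x; have := idx_le rt u x; lia.
Qed.

Lemma off_par (T : finType) (e : rel T) par d r (rt : rooting e par d r) u x :
  off par d u x = if x \in spine par d u then 0 else (off par d u (par x)).+1.
Proof.
rewrite /off /=; case: ifP => xs //; congr _.+1.
rewrite (depth_par rt); case E: (d x) => [|n] //=.
move: xs; rewrite (depth_eq0 rt E) => /negP[].
by apply/trajectP; exists (d u); rewrite ?(iter_depth rt).
Qed.

Lemma idx_par (T : finType) (e : rel T) par d r (rt : rooting e par d r) u x :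
  0 < off par d u x -> idx par d u (par x) = idx par d u x.
Proof.
by rewrite /idx (off_par rt); case: ifP => // _ _; rewrite iterSr.
Qed.

Lemma off_spine (T : finType) (e : rel T) par d r (rt : rooting e par d r) u j :
  j <= d u -> off par d u (iter j par u) = 0.
Proof. by move=> jd; rewrite (off_par rt); case: trajectP => // -[]; exists j. Qed.

Lemma idx_spine (T : finType) (e : rel T) par d r (rt : rooting e par d r) u j :
  j <= d u -> idx par d u (iter j par u) = j.
Proof.
move=> jd; have := depth_off rt u (iter j par u).
by rewrite (off_spine rt jd) (depth_iter rt); lia.
Qed.

(** On the spine the index grows by one, except at the root; off the spine it is kept. Hence
    removing all vertices of index below a bound leaves a set closed under parents. *)
Lemma idx_parW (T : finType) (e : rel T) par d r (rt : rooting e par d r) u x :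
  idx par d u x <= idx par d u (par x).
Proof.
have [o0|/(idx_par rt)->//] := posnP (off par d u x).
have := iter_off rt u x; rewrite o0 /= => xE.
have := idx_le rt u x; rewrite leq_eqVlt => /orP[/eqP iE|ilt].
  have xr : x = r by rewrite xE iE (iter_depth rt).
  by rewrite xr (par_root rt).
by rewrite {2}xE -iterS (idx_spine rt) // leqnSn.
Qed.

Lemma iter_par_off (T : finType) (e : rel T) par d r (rt : rooting e par d r) u a x :
    a <= off par d u x ->
  off par d u (iter a par x) = off par d u x - a /\
  idx par d u (iter a par x) = idx par d u x.
Proof.
elim: a => [|a IHa] ax; first by rewrite subn0.
have [oE iE] := IHa (ltnW ax).
have op : 0 < off par d u (iter a par x) by rewrite oE subn_gt0.
rewrite iterS (idx_par rt) // iE; split=> //.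
by move: oE op; rewrite (off_par rt); case: ifP => // _; lia.
Qed.

Lemma iter_closed (T : finType) (par : T -> T) (X : {set T}) i x :
  {in X, forall y, par y \in X} -> x \in X -> iter i par x \in X.
Proof. by move=> cX xX; elim: i => //= i; apply: cX. Qed.

(** As [d x <= d u], the offset of [x] is at most its index [i]. With [c = minn a m], if [i <= c]
    then [x] is reached in [c - i + off <= c <= a] steps; otherwise [c = a], and [i + off - a <= a]
    steps suffice. *)
Lemma ball_spine (T : finType) (e : rel T) par d r (rt : rooting e par d r) u a m x :
    symmetric e -> d x <= d u -> idx par d u x <= m ->
    idx par d u x + off par d u x <= 2 * a ->
  reach e a (iter (minn a m) par u) x.
Proof.
move=> esym dxu im fa; have dE := depth_off rt u x.
have down := reach_down rt (off par d u x) x esym; rewrite (iter_off rt) in down.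
set i := idx par d u x in im fa dE down *; set c := minn a m.
have [ic|ci] := leqP i c.
  apply: (@reach_leq _ _ ((c - i) + off par d u x)); first by lia.
  apply: reach_trans down; rewrite -{2}(subnK ic) iterD.
  exact: (reach_down rt).
apply: (@reach_leq _ _ ((i - c) + off par d u x)); first by lia.
apply: reach_trans down; rewrite -{2}(subnK (ltnW ci)) iterD.
exact: (reach_up rt).
Qed.

Lemma card_ge_seq (T : finType) (U : eqType) (g : T -> U) (S : {set T}) (s : seq U) :
  uniq s -> (forall i, i \in s -> exists2 x, x \in S & g x = i) -> size s <= #|S|.
Proof.
move=> us sS; rewrite -(size_image g S); apply: uniq_leq_size => // i /sS[x xS <-].
exact: image_f.
Qed.

(** * Covering a rooted tree *)

(* [u] is a deepest vertex of [X].  For a radius [r], let [y r] be the vertex at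
   distance more than [2 r] from [u] that leaves the spine first: all vertices
   leaving the spine below [y r] lie in one ball of radius [r] and form the set
   [G (ix (y r))].  Suppose that this set has fewer than [2 r] vertices for each
   [r] in [A], let [b] be the largest radius in [A], [t = ix (y b)] and [L] the
   set of radii [r] in [A] with [ix (y r) < t].  The branch of [y r] contains
   vertices at distances [2 r] and [2 r + 1] from [u], so that [G t] has at least
   [t + 2 #|L| >= b + 1 + 2 #|L|] vertices; the least radius [r] in [A] but not
   in [L] still covers [G t], and [r <= b + 1 - (#|A| - #|L|)]. *)
Lemma cover_step (T : finType) (e : rel T) par d r0 k (X : {set T}) (A : {set 'I_k}) :
    symmetric e -> rooting e par d r0 ->
    {in X, forall x, par x \in X} -> X != set0 -> A != set0 ->
  exists (r : 'I_k) (c : T) (Y : {set T}),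
    [/\ r \in A, Y \subset X, {in X :\: Y, forall x, par x \in X :\: Y},
        {in Y, forall x, reach e r c x}
      & Y = X \/ 2 * r <= #|Y| + (k - 2 * #|A|)].
Proof.
move=> esym rt cX /set0Pn[x0 x0X] /set0Pn[a0 a0A].
have [u uX umax] := @arg_maxnP _ x0 [pred x in X] d x0X.
rewrite /= in uX; have {}umax x : x \in X -> d x <= d u by apply: umax.
pose ix := idx par d u; pose f x := ix x + off par d u x.
have [b bA bmax] := @arg_maxnP _ a0 [pred r in A] val a0A.
rewrite /= in bA; have {}bmax (r : 'I_k) : r \in A -> r <= b by apply: bmax.
(* Either one ball of radius [b] covers [X], or [yb] witnesses that [y r] exists for every [r] in
   [A], since [r <= b]. *)
case: (pickP [pred y in X | 2 * b < f y]) => [yb /andP[ybX ybf]|noy]; last first.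
  exists b, (iter (minn b (d u)) par u), X; split=> //; last by left.
    by move=> x; rewrite setDv inE.
  move=> x xX; apply: (ball_spine rt) => //; first exact: umax.
    exact: (idx_le rt).
  by have := noy x; rewrite /= xX /= ltnNge => /negbFE.
pose P r := [pred y in X | 2 * r < f y].
pose y r := [arg min_(z < yb | P r z) ix z].
have yP (r : 'I_k) : r \in A ->
    [/\ y r \in X, 2 * r < f (y r)
      & forall x, x \in X -> ix x < ix (y r) -> f x <= 2 * r].
  move=> rA; have Pyb : P r yb by rewrite /= ybX /=; have := bmax r rA; lia.
  rewrite /y; case: arg_minnP => // z /andP[zX zf] zmin; split=> // x xX.
  rewrite ltnNge; case: (leqP (f x) (2 * r)) => // fx /negP[]; apply: zmin.
  by rewrite /= xX.
pose G t := [set x in X | ix x < t].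
have Gup t : {in X :\: G t, forall x, par x \in X :\: G t}.
  move=> x; rewrite !inE => /andP[+ xX]; rewrite xX cX //= andbT -!leqNgt => tx.
  by apply: leq_trans tx _; apply: (idx_parW rt).
have Gball (r : 'I_k) : r \in A ->
    {in G (ix (y r)), forall x, reach e r (iter (minn r (ix (y r))) par u) x}.
  move=> rA x; rewrite inE => /andP[xX xt]; have [_ _ yr] := yP r rA.
  by apply: (ball_spine rt) => //; [apply: umax|apply: ltnW|apply: yr].
have Gspine t : t <= (d u).+1 ->
    t <= #|[set x in G t | off par d u x == 0]|.
  move=> td; rewrite -{1}(size_iota 0 t).
  apply: (card_ge_seq (g := ix)) (iota_uniq _ _) _ => j; rewrite mem_iota /= => jt.
  have jd : j <= d u by rewrite -ltnS (leq_trans jt).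
  exists (iter j par u); last exact: (idx_spine rt).
  by rewrite !inE (off_spine rt jd) /ix (idx_spine rt jd) jt iter_closed.
have ixd x : ix x <= (d u).+1 by rewrite leqW // (idx_le rt).
have Gsplit t : #|G t| = #|[set x in G t | off par d u x == 0]| +
                         #|[set x in G t | off par d u x != 0]|.
  rewrite -(cardsID [set x | off par d u x == 0] (G t)); congr (_ + _).
    by apply: eq_card => x; rewrite !inE.
  by apply: eq_card => x; rewrite !inE andbC.
have Gsub t : G t \subset X by apply/subsetP=> x; rewrite inE => /andP[].
case: (pickP [pred r in A | 2 * r <= #|G (ix (y r))|]) => [r /andP[rA rG]|bad].
  exists r, (iter (minn r (ix (y r))) par u), (G (ix (y r))); split=> //.
  - exact: Gball.
  - by right; rewrite (leq_trans rG) // leq_addr.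
have {}bad (r : 'I_k) : r \in A -> #|G (ix (y r))| < 2 * r.
  by move=> rA; have := bad r; rewrite /= rA /= leqNgt => /negbFE.
pose t := ix (y b).
(* As [r <= b], the vertex [y b] is also a candidate for [y r]. *)
have yle (r : 'I_k) : r \in A -> ix (y r) <= t.
  move=> rA; have [yX yf _] := yP b bA; have [_ _ yr] := yP r rA.
  rewrite leqNgt; apply/negP => /(yr _ yX); have := bmax r rA; lia.
pose L := [set r in A | ix (y r) < t]; pose H := [set r in A | ix (y r) == t].
have cardA : #|A| = #|L| + #|H|.
  rewrite -(cardsID [set r : 'I_k | ix (y r) < t] A); congr (_ + _).
    by apply: eq_card => r; rewrite !inE.
  apply: eq_card => r; rewrite !inE andbC -leqNgt eqn_leq.
  by case rA: (r \in A) => //=; rewrite yle.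
have bH : b \in H by rewrite inE bA /=.
have [r rH rmin] := @arg_minnP _ b [pred r in H] val bH.
have /andP[rA /eqP rt'] : (r \in A) && (ix (y r) == t) by move: rH; rewrite /= inE.
(* The radii in [H] are distinct integers between [r] and [b]. *)
have cardH : #|H| + r <= b.+1.
  have: #|H| <= size (iota r (b.+1 - r)).
    rewrite -(size_image (val : 'I_k -> nat) H); apply: uniq_leq_size.
      by rewrite map_inj_uniq ?enum_uniq //; apply: val_inj.
    move=> i /imageP[s sH ->]; rewrite mem_iota.
    have := rmin s sH; have: s <= b by apply: bmax; move: sH; rewrite inE => /andP[].
    by rewrite /=; lia.
  by rewrite size_iota; have := bmax r rA; lia.
(* Since [u] is deepest, [off <= ix] at [y b], so [2 * t >= f (y b) > 2 * b]. *)
have tb : b < t.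
  have [yX yf _] := yP b bA; have := depth_off rt u (y b); have := umax _ yX.
  by move: yf; rewrite /f /t /ix; lia.
have cardN : #|L| * 2 <= #|[set x in G t | off par d u x != 0]|.
  have -> : #|L| * 2 = size [seq (val r, o) | r <- enum L, o <- [:: false; true]].
    by rewrite size_allpairs -cardE.
  (* Half and parity of the distance from [u] recover the radius and the bit, so the vertices found
     are distinct. *)
  apply: (card_ge_seq (g := fun x => ((f x)./2, odd (f x)))).
    apply: allpairs_uniq => //; first exact: enum_uniq.
    by move=> [r1 o1] [r2 o2] _ _ [/val_inj-> ->].
  move=> _ /allpairsP[[s o] /= [+ _ ->]]; rewrite mem_enum inE => /andP[sA st].
  have [yX yf _] := yP s sA.
  (* The spine alone contributes [ix (y s)] vertices to a set of fewer than [2 * s]; so distances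
     [2 * s] and [2 * s + 1] are attained on the branch, off the spine. *)
  have iy : ix (y s) < 2 * s.
    apply: leq_ltn_trans (bad s sA); rewrite Gsplit.
    by apply: leq_trans (leq_addr _ _); apply: Gspine.
  pose a := f (y s) - (2 * s + o).
  have ao : a <= off par d u (y s) by rewrite /a /f; lia.
  have [oE iE] := iter_par_off rt ao.
  have so : 2 * s + o <= f (y s) by case: (o); lia.
  have fE : f (iter a par (y s)) = o + (val s).*2.
    by rewrite /f /ix oE iE -/ix; move: so; rewrite /a /f -/ix /=; lia.
  exists (iter a par (y s)); last by rewrite fE half_bit_double oddD odd_double addbF oddb.
  rewrite !inE iter_closed // /ix iE -/ix st oE /=.
  by move: so; rewrite /a /f -/ix; lia.
(* Here [2 r <= 2 (b + 1) - 2 #|H| <= #|G t| + (b + 1) - 2 #|A|], and [b + 1 <= k]. *)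
exists r, (iter (minn r (ix (y r))) par u), (G (ix (y r))); split=> //.
  exact: Gball.
right; rewrite rt' Gsplit.
have := Gspine t (ixd _); have bk := ltn_ord b; lia.
Qed.

Lemma cover_radii (T : finType) (e : rel T) par d r0 k (A : {set 'I_k}) (X : {set T}) :
    symmetric e -> rooting e par d r0 -> {in X, forall x, par x \in X} ->
    #|X| + \sum_(1 <= j < #|A|.+1) (k - 2 * j) <= \sum_(r in A) 2 * r ->
  exists c : 'I_k -> T,
    {in X, forall x, exists2 r : 'I_k, r \in A & reach e r (c r) x}.
Proof.
move=> esym rt; move E: #|A| => m; elim: m A E X => [|m IHm] A E X cX.
  move/eqP: E; rewrite cards_eq0 => /eqP->; rewrite big_geq // big_set0 addn0 leqn0.
  rewrite cards_eq0 => /eqP->; exists (fun=> r0) => x; by rewrite inE.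
move=> szX; have [->|Xn0] := eqVneq X set0.
  by exists (fun=> r0) => x; rewrite inE.
have An0 : A != set0 by rewrite -card_gt0 E.
have [r [c [Y [rA YX cY bY gY]]]] := cover_step esym rt cX Xn0 An0.
have [c' c'P] : exists c' : 'I_k -> T, {in X :\: Y, forall x,
    exists2 s : 'I_k, s \in A :\ r & reach e s (c' s) x}.
  case: gY => [YE|gY]; first by exists (fun=> r0) => x; rewrite YE setDv inE.
  apply: IHm => //; first by move: E; rewrite (cardsD1 r) rA add1n => -[].
  rewrite big_nat_recr // (big_setD1 r) //= in szX; rewrite E in gY.
  move: szX; set s := (Z in _ <= _ + Z) => szX; apply: (@leq_trans s) => //.
  by have := cardsID Y X; rewrite (setIidPr YX); lia.
exists (fun s => if s == r then c else c' s) => x xX.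
have [xY|xY] := boolP (x \in Y); first by exists r; rewrite ?eqxx //; apply: bY.
have [|s] := c'P x; first by rewrite inE xY.
by rewrite !inE => /andP[/negPf sr sA] sx; exists s; rewrite ?sr.
Qed.

(** Passing from [k] to [k + 2] shifts the terms and adds a first term [k], while the last one is
    truncated to 0. For [k > 0] this fits [4 k + (k - 1)^2 = (k + 1)^2]. *)
Lemma sum_deficit k : 4 * (\sum_(1 <= j < k.+1) (k - 2 * j)) <= k.-1 ^ 2.
Proof.
have [n] := ubnP k; elim: n k => // n IHn [|[|k]] kn; first by rewrite big_geq.
  by rewrite big_nat1.
rewrite big_ltn // big_add1 /= big_nat_recr //=.
rewrite (eq_big_nat _ _ (F2 := fun j => k - 2 * j)); last by move=> j _; lia.
have := IHn k; case: k kn => [|k] kn; first by rewrite big_geq //=; lia.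
move=> /(_ (ltnW kn)) /=; lia.
Qed.

Lemma cover_balls (T : finType) (e : rel T) par d r0 k (X : {set T}) :
    symmetric e -> rooting e par d r0 -> {in X, forall x, par x \in X} ->
    4 * #|X| <= 3 * k ^ 2 ->
  exists c : 'I_k.+1 -> T,
    {in X, forall x, exists r : 'I_k.+1, reach e r (c r) x}.
Proof.
move=> esym rt cX szX.
have [|c cP] := @cover_radii T e par d r0 k.+1 setT X esym rt cX; last first.
  by exists c => x /cP[r _ rx]; exists r.
rewrite cardsT card_ord.
have -> : \sum_(r in [set: 'I_k.+1]) 2 * r = k.+1 * k.
  rewrite -big_distrr /= (eq_bigl xpredT); last by move=> i; rewrite inE.
  by elim: k {szX} => [|n IHn]; rewrite big_ord_recr ?big_ord0 //= mulnDr IHn; lia.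
have := sum_deficit k.+1; rewrite /=; nia.
Qed.

(** The root is taken in [M] when possible. A parent other than the root is adjacent to its child
    and to its own parent, so it lies in [M]. *)
Lemma burning_number_internal (T : finType) (e : rel T) k :
    symmetric e -> graph_connected e ->
    4 * #|[set x | 1 < degree e x]| <= 3 * k ^ 2 ->
  burning_number e <= k.+2.
Proof.
move=> esym [/card_gt0P[x0 _] conn] szM.
set M := [set x | 1 < degree e x] in szM *.
pose r0 := odflt x0 [pick x in M].
have [par [d rt]] := rooting_exists esym (conn r0).
pose X := r0 |: M.
have parX x : par x \in X.
  have [dx|dx] := posnP (d (par x)); first by rewrite (depth_eq0 rt dx) !inE eqxx.
  rewrite !inE; apply/orP; right.
  have dpx := depth_par rt x; have dppx := depth_par rt (par x).
  have <- : #|[set x; par (par x)]| = 2.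
    by rewrite cards2; case: eqP => // /(congr1 d); lia.
  apply: subset_leq_card; apply/subsetP => z; rewrite !inE => /orP[]/eqP->.
    by rewrite esym (edge_par rt) //; lia.
  exact: (edge_par rt).
have [c cP] : exists c : 'I_k.+1 -> T,
    {in X, forall x, exists r : 'I_k.+1, reach e r (c r) x}.
  (* If [M] is empty, [X] is still the singleton of the root, which the bound on [M] does not
     control. *)
  case: (pickP [pred x | x \in M]) => [m mM|M0].
    apply: (cover_balls esym rt) => //.
    rewrite (_ : X = M) //; apply/setUidPr; rewrite sub1set /r0.
    by case: pickP => [z|/(_ m)] //=; rewrite [m \in M]mM.
  exists (fun=> r0) => x; rewrite !inE => /orP[/eqP->|]; last first.
    by have := M0 x; rewrite /= inE => ->.
  by exists ord0; apply: reachxx.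
(* Each radius grows by one to get from a parent to its children; [s.-1] undoes this shift. *)
apply: (@burning_number_cover _ _ _ (fun s => c (inord s.-1))) => x.
have [r rx] := cP _ (parX x).
exists r.+1; first by rewrite ltnS ltn_ord.
rewrite /= inord_val -addn1; apply: reach_trans rx _.
exact: (reach_down rt 1).
Qed.

(** * Degrees in trees *)

(** Otherwise a path in [A] could be extended at its front forever: a new neighbour that already
    lies on the path would close a cycle. *)
Lemma acyclic_leaf (T : finType) (e : rel T) (A : {set T}) :
    symmetric e -> irreflexive e -> graph_acyclic e -> A != set0 ->
  exists2 x, x \in A & #|[set y in A | e x y]| <= 1.
Proof.
move=> esym eirr acyc /set0Pn[a aA].
have [/existsP[x /andP[]]|] :=
  boolP [exists x, (x \in A) && (#|[set y in A | e x y]| <= 1)]; first by exists x.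
rewrite negb_exists => /forallP nleaf.
have step m : exists x p,
    [/\ path e x p, uniq (x :: p), {subset x :: p <= A} & size p = m].
  elim: m => [|m [x [p [pP up sA sz]]]].
    by exists a, [::]; split=> // z; rewrite inE => /eqP->.
  have xA : x \in A by apply: sA; rewrite mem_head.
  (* Avoiding [head x p], the second vertex of the path, gives the cycle at least three vertices. *)
  have [z [zA exz zp]] : exists z, [/\ z \in A, e x z & z != head x p].
    have := nleaf x; rewrite xA /= -ltnNge => n1.
    have: 0 < #|[set y in A | e x y] :\ head x p|.
      by move: n1; rewrite (cardsD1 (head x p)); case: (_ \in _) => /=; lia.
    by case/card_gt0P=> z; rewrite !inE => /and3P[zp zA exz]; exists z.
  have zx : z != x by apply: contraTneq exz => ->; rewrite eirr.
  have [zin|zout] := boolP (z \in p); last first.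
    exists z, (x :: p); split; rewrite /= ?sz //.
    - by rewrite esym exz.
    - by rewrite inE (negPf zx) zout.
    - by move=> w; rewrite inE => /orP[/eqP->//|]; apply: sA.
  case/splitPr: zin pP up zp {sA sz} => p1 p2.
  case: p1 => [|w p1] pP up zp; first by rewrite /= eqxx in zp.
  case: (acyc [:: x, w & rcons p1 z]); first by rewrite /= size_rcons.
  apply/andP; split; last first.
    move: up; rewrite -cat_rcons -[x :: _]/((x :: w :: rcons p1 z) ++ p2).
    by rewrite cat_uniq => /andP[].
  rewrite /= rcons_path last_rcons (esym z) exz andbT.
  by move: pP; rewrite -cat_rcons cat_path /= => /andP[].
have [x [p [_ up sA sz]]] := step #|A|.
have: size (x :: p) <= size (enum A).
  by apply: uniq_leq_size => // w /sA; rewrite mem_enum.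
by rewrite -cardE /= sz ltnn.
Qed.

(** Deleting a vertex with at most one neighbour in [A] lowers the degree sum by at most 2, once for
    each end of the lost edge, and the right-hand side by 2. *)
Lemma acyclic_degree_sum (T : finType) (e : rel T) (A : {set T}) :
    symmetric e -> irreflexive e -> graph_acyclic e -> A != set0 ->
  \sum_(x in A) #|[set y in A | e x y]| + 2 <= 2 * #|A|.
Proof.
move=> esym eirr acyc; move E: #|A| => n; elim: n A E => [|n IHn] A E A0.
  by move: A0; rewrite -card_gt0 E.
have [x xA lx] := acyclic_leaf esym eirr acyc A0.
set B := A :\ x.
have cB : #|B| = n by move: E; rewrite (cardsD1 x) xA add1n => -[].
have nbB y : y \in B -> #|[set z in A | e y z]| = e y x + #|[set z in B | e y z]|.
  move=> yB; rewrite (cardsD1 x) inE xA /=; congr (_ + _).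
  by apply: eq_card => z; rewrite !inE andbA.
rewrite (big_setD1 x) //= -/B (eq_bigr _ nbB) big_split /=.
have -> : \sum_(y in B) e y x = #|[set y in A | e x y]|.
  rewrite -sum1_card big_mkcond [RHS]big_mkcond /=; apply: eq_bigr => y _.
  rewrite !inE esym; case: eqVneq => [->|_] /=; first by rewrite eirr andbF.
  by case: (y \in A); case: (e x y).
have [B0|Bn0] := eqVneq B set0.
  rewrite B0 big_set0 in cB *.
  have: #|[set y in A | e x y]| <= #|B|.
    apply: subset_leq_card; apply/subsetP => y; rewrite !inE => /andP[-> exy].
    by rewrite andbT; apply: contraTneq exy => ->; rewrite eirr.
  by rewrite B0 cards0; lia.
have := IHn B cB Bn0; lia.
Qed.

Lemma degree_gt0 (T : finType) (e : rel T) x :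
  symmetric e -> graph_connected e -> 1 < #|T| -> 0 < degree e x.
Proof.
move=> esym [_ conn] T1.
have [y yx] : exists y, y != x.
  have: 0 < #|[set: T] :\ x| by move: T1; rewrite -cardsT (cardsD1 x) inE /=; lia.
  by case/card_gt0P=> y; rewrite !inE andbT => yx; exists y.
case/connectP: (conn x y) yx => [[|z p] /=]; first by move=> _ ->; rewrite eqxx.
by case/andP=> exz _ _ _; apply/card_gt0P; exists z; rewrite inE.
Qed.

(** Subtract 1 per vertex from the degree sum; all degrees are positive, so the truncated
    predecessor is exact. *)
Lemma tree_degree_sum (T : finType) (e : rel T) :
  tree e -> 1 < #|T| -> 2 + \sum_x (degree e x).-1 <= #|T|.
Proof.
move=> [[esym eirr] conn acyc] T1.
have T0 : [set: T] != set0 by rewrite -card_gt0 cardsT ltnW.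
have := acyclic_degree_sum esym eirr acyc T0; rewrite cardsT.
have -> : \sum_(x in [set: T]) #|[set y in [set: T] | e x y]|
          = \sum_x (degree e x).-1 + #|T|.
  rewrite -sum1_card -big_split /=; apply: eq_big => [x|x _]; first by rewrite inE.
  rewrite addn1 prednK ?degree_gt0 //; apply: eq_card => y; by rewrite !inE.
lia.
Qed.

Lemma sum_num_deg (T : finType) (e : rel T) (F : nat -> nat) n :
  \sum_(2 <= k < n) F k * num_deg e k
  = \sum_(x | 1 < degree e x < n) F (degree e x).
Proof.
rewrite [RHS]big_mkcond /=.
rewrite (eq_bigr (fun k => \sum_x if degree e x == k then F k else 0)); last first.
  move=> k _; rewrite -big_mkcond /= sum_nat_const mulnC; congr (_ * _).
  by apply: eq_card => x; rewrite !inE.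
rewrite exchange_big /=; apply: eq_bigr => x _; case: ifP => dx.
  rewrite (bigD1_seq (degree e x)) ?iota_uniq ?mem_index_iota //= eqxx.
  by rewrite big1 ?addn0 // => k /negPf; rewrite eq_sym => ->.
rewrite big1_seq // => k /andP[_]; rewrite mem_index_iota => kn.
by case: eqP => // dk; rewrite dk kn in dx.
Qed.

Lemma degree_lt (T : finType) (e : rel T) x : irreflexive e -> degree e x < #|T|.
Proof.
move=> eirr; rewrite -cardsT; apply: proper_card; rewrite properT.
by apply/negP => /eqP/setP/(_ x); rewrite !inE eirr.
Qed.

(** * Square roots, ceilings and the theorem *)

Import Order.TTheory GRing.Theory Num.Theory.
Local Open Scope ring_scope.

Lemma ceil_2sqrt_third (R : realType) (m : nat) :
  exists2 k : nat, Num.ceil (2 * Num.sqrt (m%:R / 3 : R)) = k%:Z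
                 & (4 * m <= 3 * k ^ 2)%N.
Proof.
set x := 2 * _; have x0 : 0 <= x by rewrite mulr_ge0 ?sqrtr_ge0.
have : 0 <= Num.ceil x by rewrite ceil_ge0; apply: lt_le_trans x0; rewrite ltrN10.
case E: (Num.ceil x) => [k|//] _; exists k => //.
have xk : x <= k%:R by have := ceil_ge x; rewrite E.
have : x ^+ 2 <= k%:R ^+ 2 by rewrite lerXn2r ?nnegrE.
rewrite exprMn sqr_sqrtr ?divr_ge0 // => {}xk.
by rewrite -(ler_nat R) !natrM -expr2; lra.
Qed.

(* Every degree is less than #|T|, so the sums below contain all the nonzero
   terms of n_2 + n_3 + ... and of n_2 + 2 n_3 + 3 n_4 + ... *)
Theorem theorem8 (R : realType) (T : finType) (e : rel T) (he : tree e)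
  (h : Num.ceil (2 * Num.sqrt
         ((\sum_(2 <= k < #|T|) (num_deg e k)%:R) / 3 : R)) + 2
       <= Num.ceil (Num.sqrt
         (2 + \sum_(2 <= k < #|T|) (k.-1)%:R * (num_deg e k)%:R : R))) :
  well_burnable R e.
Proof.
have [[esym eirr] conn acyc] := he; rewrite /well_burnable.
(* A single vertex is treated apart, because [tree_degree_sum] requires two vertices. *)
have [T1|T1] := leqP #|T| 1.
  have /eqP T1E : #|T| == 1%N by rewrite eqn_leq T1; case: conn.
  rewrite T1E sqrtr1 (_ : Num.ceil 1 = 1%N%:Z); last first.
    by apply: ceil_def; rewrite subrr lexx ltr01.
  rewrite lez_nat; have [/card_gt0P[x0 _] _] := conn.
  apply: (@burning_number_cover _ _ _ (fun=> x0)) => x; exists 0%N => //.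
  have /card_le1_eqP/(_ x x0) -> // : (#|T| <= 1)%N by rewrite T1E.
  exact: reachxx.
move: h; rewrite -natr_sum; set m := (\sum_(2 <= k < _) num_deg e k)%N.
have -> : m = #|[set x | (1 < degree e x)%N]|.
  rewrite /m -sum1_card.
  transitivity (\sum_(2 <= k < #|T|) 1 * num_deg e k)%N.
    by apply: eq_bigr => k _; rewrite mul1n.
  rewrite (sum_num_deg e (fun=> 1%N)); apply: eq_bigl => x.
  by rewrite inE degree_lt // andbT.
have [k -> szk] := ceil_2sqrt_third R #|[set x | (1 < degree e x)%N]|.
under eq_bigr do rewrite -natrM.
rewrite -natr_sum -[2 in X in _ <= X]/(2%:R) -natrD (sum_num_deg e predn) => hk.
have bk := burning_number_internal esym conn szk.
apply: le_trans (_ : k%:Z + 2 <= _); first by rewrite -[2]/(2%N%:Z) -PoszD lez_nat addn2.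
apply: le_trans hk _; apply: le_ceil; rewrite ler_sqrt // ler_nat.
apply: leq_trans (tree_degree_sum he T1); rewrite leq_add2l.
by rewrite [leqRHS](bigID (fun x => 1 < degree e x < #|T|)%N) /= leq_addr.
Qed.
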